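(* Let $F$ be an order continuous Banach lattice, $H$ a Banach space and $T:F\to H$ a bounded linear operator. The following are equivalent: (i) $T$ is DNS; (ii) $T$ is $\infty$-DNS; (iii) $T$ is $n$-DNS for some $n\in\mathbb{N}$, $n\ge 2$; (iv) $T$ complements $\tau_F$; (iv$'$) $T$ sequentially complements $\tau_F$.
   Context: $\mathrm{S}_F$ denotes the unit sphere of $F$; $f,g$ are disjoint if $|f|\wedge|g|=0$. A bounded operator $S$ is strictly singular if it is not bounded below on any infinite-dimensional subspace. $T$ is DNS (disjointly non-singular) if for every disjoint sequence $(f_n)$ of nonzero vectors of $F$, the restriction of $T$ to $\overline{\mathrm{span}}\{f_n\}$ is not strictly singular (equivalently, as is known, there is no disjoint sequence $(f_n)\subset\mathrm{S}_F$ with $\|Tf_n\|\to0$). For $n\in\{2,3,\dots\}$, $T$ is $n$-DNS if there is $r>0$ such that there is no pairwise disjoint $n$-tuple $f_1,\dots,f_n\in\mathrm{S}_F$ with $\|Tf_k\|\le r$ for all $k$; $T$ is $\infty$-DNS if there is $r>0$ such that $\liminf_n\|Tf_n\|>r$ for every disjoint sequence $(f_n)\subset\mathrm{S}_F$. The unbounded norm (un-) topology on $F$ is the linear topology with base of zero neighborhoods $\{f\in F:\||f|\wedge h\|<\varepsilon\}$, $h\in F_+$, $\varepsilon>0$. For order continuous $F$, $\tau_F$ denotes the un-topology (which is the weakest Hausdorff order continuous locally solid topology on $F$, and coincides with the unbounded absolute weak topology). For a linear topology $\tau$ on $F$, $T$ complements $\tau$ if there is no net $(f_p)\subset\mathrm{S}_F$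 which is $\tau$-null and satisfies $\|Tf_p\|\to0$; $T$ sequentially complements $\tau$ if the same holds for sequences. *)

(* Defs.v *)
From HB Require Import structures.
From mathcomp Require Import all_boot all_order all_algebra.
From mathcomp Require Import all_classical all_reals all_analysis.
Set Implicit Arguments. Unset Strict Implicit. Unset Printing Implicit Defensive.
Import Order.TTheory GRing.Theory Num.Theory.
Import numFieldNormedType.Exports.
Local Open Scope classical_set_scope.
Local Open Scope ring_scope.

Section BanachLattice.
Variables (R : realType) (F : normedModType R).
Variables (le : F -> F -> Prop) (join : F -> F -> F).

Definition lmeet (x y : F) : F := - join (- x) (- y).
Definition labs (x : F) : F := join x (- x).

Definition is_normed_lattice : Prop :=
  (forall x, le x x) /\
  (forall x y, le x y -> le y x -> x = y) /\
  (forall x y z, le x y -> le y z -> le x z) /\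
  (forall x y z, le x y -> le (x + z) (y + z)) /\
  (forall (a : R) x y, 0 <= a -> le x y -> le (a *: x) (a *: y)) /\
  (forall x y, le x (join x y) /\ le y (join x y) /\
               (forall z, le x z -> le y z -> le (join x y) z)) /\
  (forall x y, le (labs x) (labs y) -> `|x| <= `|y|).

Definition directed (D : Type) (ord : D -> D -> Prop) : Prop :=
  inhabited D /\ (forall p, ord p p) /\
  (forall p q r, ord p q -> ord q r -> ord p r) /\
  (forall p q, exists r, ord p r /\ ord q r).

Definition net_to0 (D : Type) (ord : D -> D -> Prop) (u : D -> R) : Prop :=
  forall e : R, 0 < e -> exists p0, forall p, ord p0 p -> `|u p| < e.

Definition order_continuous : Prop :=
  forall (D : Type) (ord : D -> D -> Prop) (x : D -> F),
    directed ord ->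
    (forall p q, ord p q -> le (x q) (x p)) ->
    (forall p, le 0 (x p)) ->
    (forall g, (forall p, le g (x p)) -> le g 0) ->
    net_to0 ord (fun p => `|x p|).

Definition disjoint (f g : F) : Prop := lmeet (labs f) (labs g) = 0.
Definition in_sphere (f : F) : Prop := `|f| = 1.
Definition disjoint_seq (f : nat -> F) : Prop :=
  forall n m, n <> m -> disjoint (f n) (f m).

(* un-topology (= tau_F for order continuous F): a net is null iff
   || |f_p| /\ h || -> 0 for every h >= 0 *)
Definition un_null_net (D : Type) (ord : D -> D -> Prop) (f : D -> F) : Prop :=
  forall h, le 0 h -> net_to0 ord (fun p => `|lmeet (labs (f p)) h|).

Definition un_null_seq (f : nat -> F) : Prop :=
  forall h, le 0 h -> (fun n => `|lmeet (labs (f n)) h|) @ \oo --> (0 : R).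

Variable (H : normedModType R) (T : F -> H).

Definition subspace (Y : set F) : Prop :=
  Y 0 /\ forall (a : R) x y, Y x -> Y y -> Y (a *: x + y).

Definition lin_span (f : nat -> F) : set F :=
  [set x | exists (n : nat) (a : nat -> R), x = \sum_(i < n) a i *: f i].

Definition closed_span (f : nat -> F) : set F := closure (lin_span f).

Definition infinite_dim (Y : set F) : Prop :=
  forall n : nat, exists y : 'I_n -> F, (forall i, Y (y i)) /\
    forall a : 'I_n -> R, \sum_(i < n) a i *: y i = 0 -> forall i, a i = 0.

Definition bounded_below_on (Y : set F) : Prop :=
  exists c : R, 0 < c /\ forall y, Y y -> c * `|y| <= `|T y|.

Definition strictly_singular_on (X : set F) : Prop :=
  forall Y, subspace Y -> Y `<=` X -> infinite_dim Y -> ~ bounded_below_on Y.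

Definition DNS : Prop :=
  forall f : nat -> F, disjoint_seq f -> (forall n, f n != 0) ->
    ~ strictly_singular_on (closed_span f).

Definition n_DNS (n : nat) : Prop :=
  exists r : R, 0 < r /\
    ~ exists f : 'I_n -> F,
        [/\ (forall i j, i != j -> disjoint (f i) (f j)),
            (forall i, in_sphere (f i))
          & (forall i, `|T (f i)| <= r)].

(* liminf_n ||T f_n|| > r, written out: some s > r is eventually below ||T f_n|| *)
Definition inf_DNS : Prop :=
  exists r : R, 0 < r /\
    forall f : nat -> F, disjoint_seq f -> (forall n, in_sphere (f n)) ->
      exists s : R, r < s /\ exists N, forall n, (N <= n)%N -> s <= `|T (f n)|.

Definition complements_tauF : Prop :=
  forall (D : Type) (ord : D -> D -> Prop) (f : D -> F), directed ord ->
    ~ [/\ (forall p, in_sphere (f p)), un_null_net ord f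
        & net_to0 ord (fun p => `|T (f p)|)].

Definition seq_complements_tauF : Prop :=
  forall f : nat -> F,
    ~ [/\ (forall n, in_sphere (f n)), un_null_seq f
        & (fun n => `|T (f n)|) @ \oo --> (0 : R)].

End BanachLattice.

(* Main.v *)
Require Import Defs.
From HB Require Import structures.
From mathcomp Require Import all_boot all_order all_algebra.
From mathcomp Require Import all_classical all_reals all_analysis.
From mathcomp Require Import lra ring.
Import Order.TTheory GRing.Theory Num.Theory.
Import numFieldNormedType.Exports.
Local Open Scope ring_scope.

Set Implicit Arguments.
Unset Strict Implicit.
Unset Printing Implicit Defensive.

(** Call [T] degenerate if for all [e > 0] and [h >= 0] there is a unit vector [g] with
    [|T g| < e] and [| |g| /\ h | < e].  All five conditions say that [T] is not
    degenerate.

    In an order continuous Banach lattice, [n] disjoint elements of an order interval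
    [0, h] cannot all have norm at least [e] once [n] is large; the norming functionals
    of Hahn-Banach are essential here.  Hence disjoint unit sequences, and one member of
    every long enough disjoint unit tuple, are almost disjoint from a given [h], so the
    failure of any of the conditions makes [T] degenerate.

    Conversely, if [T] is degenerate, a Kadec-Pelczynski perturbation yields a disjoint
    unit sequence [f] with [|T (f m)| <= 2^-m].  It is un-null and contradicts the other
    conditions at once; it contradicts DNS because the coordinates along [f] are
    contractive, so that [T] is small on elements of the closed span of [f] whose first
    coordinates vanish, and every infinite-dimensional subspace contains such elements. *)

(** * Hahn-Banach through minimal sublinear functionals *)

Section Sublinear.
Variables (R : realType) (V : lmodType R).
Local Open Scope classical_set_scope.

(** Homogeneity is asked only as an inequality for [s > 0], which infima inherit easily; applying it
    to [s^-1] as well recovers equality. *)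
Definition sublinear (q : V -> R) : Prop :=
  (forall x y, q (x + y) <= q x + q y) /\
  (forall (s : R) x, 0 < s -> q (s *: x) <= s * q x).

Lemma sublinear0 q : sublinear q -> q 0 = 0.
Proof.
move=> [_ qZ]; have h2 := qZ 2 0 (ltr0Sn _ _); have := qZ 2^-1 0.
rewrite !scaler0 in h2 *; move=> /(_ ltac:(lra)) h3; lra.
Qed.

Lemma sublinearN q x : sublinear q -> - q (- x) <= q x.
Proof. by move=> sq; have := sq.1 x (- x); rewrite subrr sublinear0//; lra. Qed.

Lemma sublinearZ q s x : sublinear q -> 0 <= s -> q (s *: x) = s * q x.
Proof.
move=> sq; rewrite le_eqVlt => /predU1P[<-|s0].
  by rewrite scale0r mul0r sublinear0.
apply/eqP; rewrite eq_le sq.2//= mulrC -ler_pdivlMr// mulrC.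
have := sq.2 s^-1 (s *: x); rewrite scalerA mulVf ?gt_eqF// scale1r invr_gt0.
exact.
Qed.

(** With [t = 1/s] the terms are the difference quotients of [q] at [y] in the direction [x], so by
    convexity this is the one-sided directional derivative of [q] at [y]. *)
Definition directional (q : V -> R) (y x : V) : R :=
  inf [set q (x + t *: y) - t * q y | t in [set t | 0 <= t]].

Section Directional.
Variables (q : V -> R) (y : V).
Hypothesis sq : sublinear q.

Lemma directional_le x t : 0 <= t -> directional q y x <= q (x + t *: y) - t * q y.
Proof.
move=> t0; apply: ge_inf; last by exists t.
exists (- q (- x)) => _ [s /= s0 <-].
have := sq.1 (x + s *: y) (- x); rewrite addrAC subrr add0r sublinearZ//; lra.
Qed.

Lemma le_directional x m :
  (forall t, 0 <= t -> m <= q (x + t *: y) - t * q y) -> m <= directional q y x.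
Proof.
move=> mle; apply: lb_le_inf; first by eexists; exists 0; rewrite /=.
by move=> _ [t /= t0 <-]; exact: mle.
Qed.

Lemma directional_sublinear : sublinear (directional q y).
Proof.
split=> [x z|s x s0].
- rewrite -lerBlDr; apply: le_directional => t t0.
  rewrite lerBlDr [leRHS]addrC -lerBlDr; apply: le_directional => u u0.
  rewrite lerBlDr; apply: (le_trans (directional_le (x + z) (addr_ge0 t0 u0))).
  have := sq.1 (x + t *: y) (z + u *: y).
  by rewrite addrACA -scalerDl; lra.
- rewrite mulrC -ler_pdivrMr//; apply: le_directional => t t0.
  rewrite ler_pdivrMr// [leRHS]mulrC.
  apply: (le_trans (directional_le (s *: x) (mulr_ge0 (ltW s0) t0))).
  by rewrite -scalerA -scalerDr sublinearZ ?(ltW s0)// -mulrA -mulrBr.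
Qed.

Lemma directional_le_id x : directional q y x <= q x.
Proof. by have := directional_le x (lexx 0); rewrite scale0r mul0r addr0 subr0. Qed.

Lemma directionalN : directional q y (- y) <= - q y.
Proof. by have := directional_le (- y) ler01; rewrite scale1r addNr sublinear0//; lra. Qed.

End Directional.

Lemma minimal_sublinear p : sublinear p ->
  exists q, [/\ sublinear q, (forall x, q x <= p x) &
    forall q', sublinear q' -> (forall x, q' x <= q x) -> q' = q].
Proof.
move=> sp; pose S := {q | sublinear q /\ forall x, q x <= p x}.
(* The order is reversed, so that a maximal element for Zorn is a minimal functional. *)
pose r (s t : S) := `[< forall x, sval t x <= sval s x >].
have sP (s : S) : sublinear (sval s) by case: (svalP s).
have pP (s : S) x : sval s x <= p x by case: (svalP s).
case: (@Zorn S r).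
- by move=> t; apply/asboolP.
- move=> a b c /asboolP ab /asboolP bc; apply/asboolP => x.
  exact: le_trans (bc x) (ab x).
- move=> a b /asboolP ab /asboolP ba; apply: eq_sig_hprop => [?|].
    exact: Prop_irrelevance.
  by apply/funext => x; apply/le_anti; rewrite ab ba.
- move=> A totA; have [[a0 Aa0]|A0] := pselect (A !=set0); last first.
    exists (exist _ p (conj sp (fun=> lexx _))) => s As.
    by case: A0; exists s.
  pose m x := inf [set sval s x | s in A].
  have mle s x : A s -> m x <= sval s x.
    move=> As; apply: ge_inf; last by exists s.
    exists (- p (- x)) => _ [t At <-].
    by have := sublinearN x (sP t); have := pP t (- x); lra.
  have le_m x c : (forall s, A s -> c <= sval s x) -> c <= m x.
    move=> cle; apply: lb_le_inf; first by exists (sval a0 x); exists a0.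
    by move=> _ [s As <-]; exact: cle.
  clearbody m; have sm : sublinear m.
    split=> [x y|s x s0].
    + rewrite -lerBlDr; apply: (le_m x) => a Aa.
      rewrite lerBlDr [leRHS]addrC -lerBlDr; apply: (le_m y) => b Ab; rewrite lerBlDr.
      have [/asboolP ab|/asboolP ba] := totA _ _ Aa Ab.
      * apply: (le_trans (mle b _ Ab)); have := (sP b).1 x y; have := ab x; lra.
      * apply: (le_trans (mle a _ Aa)); have := (sP a).1 x y; have := ba y; lra.
    + rewrite mulrC -ler_pdivrMr//; apply: (le_m x) => a Aa.
      by rewrite ler_pdivrMr// mulrC (le_trans (mle a _ Aa))//; apply: (sP a).2.
  have mp x : m x <= p x by apply: le_trans (pP a0 x); exact: mle.
  exists (exist _ m (conj sm mp)) => s As; apply/asboolP => x; exact: mle.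
- move=> [q [sq qp]] minq; exists q; split=> // q' sq' q'q.
  have q'p x : q' x <= p x by exact: le_trans (qp x).
  have /(congr1 sval)// := minq (exist _ q' (conj sq' q'p)) ltac:(exact/asboolP).
Qed.

(* Hahn-Banach: replacing [p] by [directional p x0] forces the value at [x0],
   and a minimal sublinear functional is additive since it equals all its
   directional regularisations. *)
Lemma sublinear_additive_minorant p x0 : sublinear p ->
  exists phi : V -> R, [/\ (forall x y, phi (x + y) = phi x + phi y),
    (forall x, phi x <= p x) & phi x0 = p x0].
Proof.
move=> sp; have [q [sq qp minq]] := minimal_sublinear (directional_sublinear x0 sp).
have qN x : q (- x) = - q x.
  have /(congr1 (@^~ (- x))) := minq _ (directional_sublinear x sq)
    (directional_le_id x sq).
  by have := directionalN x sq; have := sublinearN x sq; move=> /= ? ? ?; lra.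
have qlep x : q x <= p x by exact: le_trans (qp x) (directional_le_id x0 sp x).
exists q; split => // [x y|].
- have := sq.1 x y; have := sq.1 (- x) (- y); rewrite -opprD !qN; lra.
- have := qlep x0; have := qp (- x0); have := directionalN x0 sp; rewrite qN; lra.
Qed.

End Sublinear.

(** * Normed lattices *)

Section NormedLattice.
Variables (R : realType) (F : normedModType R).
Variables (le : F -> F -> Prop) (join : F -> F -> F).
Hypothesis HF : is_normed_lattice le join.

Local Notation "x <=F y" := (le x y) (at level 70).
Local Notation meet := (lmeet join).
Local Notation abs := (labs join).

Lemma subrACA (a b c d : F) : a - b - (c - d) = (a - c) - (b - d).
Proof. by rewrite !opprB [d - c]addrC addrACA [- b + d]addrC. Qed.

Lemma lef_refl x : x <=F x. Proof. exact: HF.1. Qed.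

Lemma lef_anti x y : x <=F y -> y <=F x -> x = y. Proof. exact: HF.2.1. Qed.

Lemma lef_trans y x z : x <=F y -> y <=F z -> x <=F z.
Proof. exact: HF.2.2.1. Qed.

Lemma lefD2r z x y : x <=F y -> x + z <=F y + z.
Proof. exact: HF.2.2.2.1. Qed.

Lemma lefZ (a : R) x y : 0 <= a -> x <=F y -> a *: x <=F a *: y.
Proof. exact: HF.2.2.2.2.1. Qed.

Lemma lef_joinl x y : x <=F join x y. Proof. by case: (HF.2.2.2.2.2.1 x y). Qed.

Lemma lef_joinr x y : y <=F join x y. Proof. by case: (HF.2.2.2.2.2.1 x y) => _ []. Qed.

Lemma join_lef x y z : x <=F z -> y <=F z -> join x y <=F z.
Proof. by case: (HF.2.2.2.2.2.1 x y) => _ [_]; apply. Qed.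

(** * Order arithmetic, meets and joins *)

Lemma lef_BlDr x y z : (x - y <=F z) = (x <=F z + y).
Proof.
by apply/propext; split=> [/(lefD2r y)|/(lefD2r (- y))]; rewrite ?subrK ?addrK.
Qed.

Lemma lef_BrDr x y z : (x <=F y - z) = (x + z <=F y).
Proof.
by apply/propext; split=> [/(lefD2r z)|/(lefD2r (- z))]; rewrite ?subrK ?addrK.
Qed.

Lemma lef_subge0 x y : (0 <=F y - x) = (x <=F y).
Proof. by rewrite lef_BrDr add0r. Qed.

Lemma lefD x y z t : x <=F y -> z <=F t -> x + z <=F y + t.
Proof.
move=> xy zt; apply: (lef_trans (lefD2r z xy)).
by rewrite ![y + _]addrC; exact: lefD2r.
Qed.

Lemma lefN x y : x <=F y -> - y <=F - x.
Proof. by move=> xy; rewrite -lef_subge0 opprK addrC lef_subge0. Qed.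

Lemma lef_oppl x y : (- x <=F y) = (- y <=F x).
Proof. by rewrite -lef_subge0 -[RHS]lef_subge0 !opprK addrC. Qed.

Lemma lefNr x : (0 <=F - x) = (x <=F 0).
Proof. by rewrite -[RHS]lef_subge0 sub0r. Qed.

Lemma lef_addge0 x y : 0 <=F x -> 0 <=F y -> 0 <=F x + y.
Proof. by move=> x0 y0; rewrite -[0]addr0; exact: lefD. Qed.

Lemma lef_addl x y : 0 <=F y -> x <=F x + y.
Proof. by move=> y0; rewrite -{1}[x]addr0; apply: lefD => //; exact: lef_refl. Qed.

Lemma lef_addr x y : 0 <=F y -> x <=F y + x.
Proof. by rewrite addrC; exact: lef_addl. Qed.

Lemma lef_scale_ge0 (a : R) x : 0 <= a -> 0 <=F x -> 0 <=F a *: x.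
Proof. by move=> a0 /(lefZ a0); rewrite scaler0. Qed.

Lemma lefZ_le (a b : R) x : a <= b -> 0 <=F x -> a *: x <=F b *: x.
Proof.
by move=> ab x0; rewrite -lef_subge0 -scalerBl; apply: lef_scale_ge0 => //; lra.
Qed.

Lemma lef_sum_ge0 I (s : seq I) (P : pred I) (G : I -> F) :
  (forall i, P i -> 0 <=F G i) -> 0 <=F \sum_(i <- s | P i) G i.
Proof.
move=> G0; elim/big_ind: _ => //; [exact: lef_refl|exact: lef_addge0].
Qed.

Lemma lef_big (I : eqType) (s : seq I) (G : I -> F) j :
  (forall i, 0 <=F G i) -> j \in s -> G j <=F \sum_(i <- s) G i.
Proof.
move=> G0; elim: s => // i s IH; rewrite inE big_cons => /predU1P[->|/IH js].
  by apply: lef_addl; exact: lef_sum_ge0.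
exact: lef_trans (lef_addr _ (G0 i)).
Qed.

Lemma lef_meetl x y : meet x y <=F x.
Proof. by rewrite lef_oppl; exact: lef_joinl. Qed.

Lemma lef_meetr x y : meet x y <=F y.
Proof. by rewrite lef_oppl; exact: lef_joinr. Qed.

Lemma lef_meet z x y : z <=F x -> z <=F y -> z <=F meet x y.
Proof.
by move=> zx zy; rewrite -[z]opprK; apply: lefN; apply: join_lef; exact: lefN.
Qed.

Lemma lef_meet2 x y z t : x <=F y -> z <=F t -> meet x z <=F meet y t.
Proof.
move=> xy zt; apply: lef_meet; [apply: lef_trans xy|apply: lef_trans zt].
  exact: lef_meetl.
exact: lef_meetr.
Qed.

Lemma meet_ge0 x y : 0 <=F x -> 0 <=F y -> 0 <=F meet x y.
Proof. exact: lef_meet. Qed.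

(** Subtracting [b] from the left side leaves an element below both [a] and [c]. *)
Lemma lef_meetD a b c : 0 <=F a -> 0 <=F b -> 0 <=F c ->
  meet a (b + c) <=F meet a b + meet a c.
Proof.
move=> a0 b0 c0; set w := meet _ _.
have wb : w - b <=F meet a c.
  apply: lef_meet; rewrite lef_BlDr; last by rewrite addrC; exact: lef_meetr.
  by apply: lef_trans (lef_addl _ b0); exact: lef_meetl.
rewrite -lef_BlDr; apply: lef_meet; rewrite lef_BlDr; last by rewrite addrC -lef_BlDr.
apply: lef_trans (lef_addl _ (meet_ge0 a0 c0)); exact: lef_meetl.
Qed.

Lemma lef_meetDr a b c : 0 <=F c -> meet a (b + c) <=F meet a b + c.
Proof.
move=> c0; rewrite -lef_BlDr; apply: lef_meet; rewrite lef_BlDr; last exact: lef_meetr.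
exact: lef_trans (lef_meetl _ _) (lef_addl _ c0).
Qed.

(** * Absolute value, norm and closedness of the positive cone *)

Lemma lef_abs x : x <=F abs x. Proof. exact: lef_joinl. Qed.

Lemma lefN_abs x : - x <=F abs x. Proof. exact: lef_joinr. Qed.

Lemma abs_lef x z : x <=F z -> - x <=F z -> abs x <=F z.
Proof. exact: join_lef. Qed.

Lemma abs_ge0 x : 0 <=F abs x.
Proof.
have := lefD (lef_abs x) (lefN_abs x); rewrite subrr -mulr2n -scaler_nat.
have h2 : (0 : R) <= 2^-1 by lra.
by move=> /(lefZ h2); rewrite scaler0 scalerA mulVf ?pnatr_eq0// scale1r.
Qed.

Lemma abs_id x : 0 <=F x -> abs x = x.
Proof.
move=> x0; apply: lef_anti (lef_abs x); apply: abs_lef; first exact: lef_refl.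
by apply: (lef_trans _ x0); rewrite -lefNr opprK.
Qed.

Lemma absN x : abs (- x) = abs x.
Proof.
by apply: lef_anti; apply: abs_lef; rewrite ?opprK;
  (exact: lefN_abs || exact: lef_abs || (rewrite -{1}[x]opprK; exact: lefN_abs)).
Qed.

Lemma norm_lef_abs x y : abs x <=F abs y -> `|x| <= `|y|.
Proof. exact: HF.2.2.2.2.2.2. Qed.

Lemma norm_abs x : `|abs x| = `|x|.
Proof.
by apply/le_anti/andP; split; apply: norm_lef_abs; rewrite (abs_id (abs_ge0 x));
  exact: lef_refl.
Qed.

Lemma norm_lef x y : 0 <=F x -> x <=F y -> `|x| <= `|y|.
Proof.
move=> x0 xy; apply: norm_lef_abs; rewrite !abs_id//; exact: lef_trans xy.
Qed.

Lemma absD x y : abs (x + y) <=F abs x + abs y.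
Proof.
by apply: abs_lef; rewrite ?opprD; apply: lefD; (exact: lefN_abs || exact: lef_abs).
Qed.

Lemma absZ (a : R) x : abs (a *: x) <=F `|a| *: abs x.
Proof.
wlog a0 : a x / 0 <= a.
  move=> H; have [|a0] := leP 0 a; first exact: H.
  have := H (- a) (- x); rewrite scalerN scaleNr opprK normrN absN; apply; lra.
rewrite ger0_norm//; apply: abs_lef; rewrite -?scalerN; apply: lefZ => //;
  (exact: lefN_abs || exact: lef_abs).
Qed.

(** For every [z] in the cone the negative part of [x] is dominated by [abs (x - z)], so its norm is
    below every [e]. *)
Lemma ge0_approx x :
  (forall e : R, 0 < e -> exists2 z, 0 <=F z & `|x - z| < e) -> 0 <=F x.
Proof.
move=> H; have pos y : 0 <=F join y 0 by exact: lef_joinr.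
suff /eqP x0 : join (- x) 0 == 0.
  by rewrite -[x]opprK lefNr -x0; exact: lef_joinl.
rewrite -normr_le0; apply/ler_addgt0Pr => e /H[z z0 xz]; rewrite add0r.
apply: le_trans (ltW xz); rewrite -(norm_abs (x - z)).
apply: norm_lef => //; apply: join_lef; last exact: abs_ge0.
apply: lef_trans (lefN_abs _).
by rewrite opprB lef_BrDr addNr.
Qed.

Lemma lef_approx x y :
  (forall e : R, 0 < e -> exists x' y', [/\ x' <=F y', `|x - x'| < e & `|y - y'| < e]) ->
  x <=F y.
Proof.
move=> H; rewrite -lef_subge0; apply: ge0_approx => e e0.
have [|x' [y' [xy xx yy]]] := H (e / 2); first lra.
exists (y' - x'); first by rewrite lef_subge0.
rewrite subrACA; apply: le_lt_trans (ler_normB _ _) _; lra.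
Qed.

(** The positive elements [n^-1 *: v - x] converge to [- x], and the positive cone is closed. *)
Lemma lef_archimedean x v : (forall n, x *+ n <=F v) -> x <=F 0.
Proof.
move=> H; rewrite -lefNr; apply: ge0_approx => e e0.
have [n vn] : exists n : nat, `|v| / e < n.+1%:R.
  exists (Num.truncn (`|v| / e)); exact: truncnS_gt.
have n0 : (0 : R) < n.+1%:R by rewrite ltr0n.
exists (n.+1%:R^-1 *: v - x).
  have in0 : (0 : R) <= n.+1%:R^-1 by rewrite invr_ge0 ltW.
  rewrite lef_subge0; have := lefZ in0 (H n.+1).
  by rewrite -(scaler_nat _ x) scalerA mulVf ?gt_eqF// scale1r.
rewrite opprB addrA addNr sub0r normrN normrZ ger0_norm ?invr_ge0 ?ltW//.
by rewrite mulrC ltr_pdivrMr// mulrC -ltr_pdivrMr.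
Qed.

(** * Disjointness *)

Definition pdisj a b : Prop :=
  [/\ 0 <=F a, 0 <=F b & forall w, w <=F a -> w <=F b -> w <=F 0].

(** Phrased through common lower bounds, disjointness passes to smaller elements, sums and multiples
    without computing meets. *)
Lemma disjointP x y : Defs.disjoint join x y <-> pdisj (abs x) (abs y).
Proof.
rewrite /Defs.disjoint; split=> [xy0|[x0 y0 xy]].
  split; try exact: abs_ge0.
  by move=> w wx wy; rewrite -xy0; exact: lef_meet.
apply: lef_anti; last exact: meet_ge0.
by apply: xy; [exact: lef_meetl|exact: lef_meetr].
Qed.

Lemma pdisjC a b : pdisj a b -> pdisj b a.
Proof. by case=> a0 b0 ab; split=> // w wb wa; exact: ab. Qed.

Lemma pdisj_le a b a' b' : 0 <=F a -> 0 <=F b -> a <=F a' -> b <=F b' ->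
  pdisj a' b' -> pdisj a b.
Proof.
move=> a0 b0 aa bb [_ _ H]; split=> // w wa wb.
by apply: H; [exact: lef_trans aa|exact: lef_trans bb].
Qed.

Lemma pdisjD a b c : pdisj a b -> pdisj a c -> pdisj a (b + c).
Proof.
move=> [a0 b0 ab] [_ c0 ac]; split=> //; first exact: lef_addge0.
move=> w wa wbc.
apply: lef_trans (lef_meet wa wbc) _; apply: lef_trans (lef_meetD _ _ _) _ => //.
rewrite -[0]addr0; apply: lefD.
  by apply: ab; [exact: lef_meetl|exact: lef_meetr].
by apply: ac; [exact: lef_meetl|exact: lef_meetr].
Qed.

Lemma pdisjZ (s : R) a b : 0 <= s -> pdisj a b -> pdisj a (s *: b).
Proof.
move=> s0 [a0 b0 ab]; split=> //; first exact: lef_scale_ge0.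
move=> w wa wb.
(* Scaling by [(1 + s)^-1] puts [w] below both [a] and [b], whether or not [s] exceeds 1. *)
have s1 : 0 < 1 + s by lra.
have is1 : 0 <= (1 + s)^-1 by rewrite invr_ge0 ltW.
have : (1 + s)^-1 *: w <=F 0.
  apply: ab.
    apply: lef_trans (lefZ is1 wa) _; rewrite -[a in X in _ <=F X]scale1r.
    by apply: lefZ_le => //; rewrite invf_le1//; lra.
  apply: lef_trans (lefZ is1 wb) _; rewrite scalerA -[b in X in _ <=F X]scale1r.
  by apply: lefZ_le => //; rewrite mulrC ler_pdivrMr//; lra.
by move=> /(lefZ (ltW s1)); rewrite scaler0 scalerA mulfV ?gt_eqF// scale1r.
Qed.

(** If [w] is a common lower bound, then [join z 0 - w] still dominates [z] and 0, hence [join z 0];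
    so [w] is at most 0. *)
Lemma pdisj_pos z : pdisj (join z 0) (join (- z) 0).
Proof.
split; try exact: lef_joinr.
move=> w wz wNz.
have : join z 0 <=F join z 0 - w.
  apply: join_lef; last by rewrite lef_subge0.
  rewrite lef_BrDr addrC -lef_BrDr.
  apply: lef_trans wNz _; apply: join_lef; last by rewrite lef_subge0; exact: lef_joinl.
  by rewrite lef_BrDr addNr; exact: lef_joinr.
by rewrite lef_BrDr addrC -lef_BrDr subrr.
Qed.

(** The element [a + b - h] lies below both [a] and [b]. *)
Lemma pdisj_add_le a b h : pdisj a b -> a <=F h -> b <=F h -> a + b <=F h.
Proof.
move=> [_ _ ab] ah bh; rewrite -lef_subge0 -[_ - _]opprB lefNr.
apply: ab; rewrite lef_BlDr.
  by apply: lefD => //; exact: lef_refl.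
by rewrite addrC; apply: lefD => //; exact: lef_refl.
Qed.

Lemma pdisj_sum (I : finType) (P : pred I) (G : I -> F) a : 0 <=F a ->
  (forall i, P i -> pdisj a (G i)) -> pdisj a (\sum_(i | P i) G i).
Proof.
move=> a0 aG; elim/big_ind: _ => //; last exact: pdisjD.
by split=> //; exact: lef_refl.
Qed.

Lemma sum_pdisj_le n (G : 'I_n -> F) h :
  (forall i j, i != j -> pdisj (G i) (G j)) ->
  (forall i, 0 <=F G i) -> (forall i, G i <=F h) -> 0 <=F h ->
  \sum_i G i <=F h.
Proof.
move=> GG G0 Gh h0.
elim: n G GG G0 Gh => [|n IH] G GG G0 Gh; first by rewrite big_ord0.
rewrite big_ord_recl; apply: pdisj_add_le => //.
  by apply: pdisj_sum => // i _; apply: GG; rewrite neq_lift.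
by apply: IH => // i j ij; apply: GG; rewrite (inj_eq lift_inj).
Qed.

Lemma disjointC x y : Defs.disjoint join x y -> Defs.disjoint join y x.
Proof. by move=> /disjointP/pdisjC/disjointP. Qed.

Lemma disjoint_addr z x y :
  Defs.disjoint join z x -> Defs.disjoint join z y -> Defs.disjoint join z (x + y).
Proof.
move=> /disjointP zx /disjointP zy; apply/disjointP.
apply: pdisj_le (pdisjD zx zy); try exact: abs_ge0.
  exact: lef_refl.
exact: absD.
Qed.

Lemma disjoint_scaler (a : R) z x :
  Defs.disjoint join z x -> Defs.disjoint join z (a *: x).
Proof.
move=> /disjointP zx; apply/disjointP.
apply: pdisj_le (pdisjZ (normr_ge0 a) zx); try exact: abs_ge0.
  exact: lef_refl.
exact: absZ.
Qed.

Lemma disjoint0r z : Defs.disjoint join z 0.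
Proof.
apply/disjointP; split; try exact: abs_ge0.
by move=> w _; rewrite (abs_id (lef_refl 0)).
Qed.

Lemma disjoint_sumr I (s : seq I) (P : pred I) (G : I -> F) z :
  (forall i, P i -> Defs.disjoint join z (G i)) ->
  Defs.disjoint join z (\sum_(i <- s | P i) G i).
Proof.
move=> zG; elim/big_ind: _ => //; [exact: disjoint0r|exact: disjoint_addr].
Qed.

(** [abs x] is below [abs (x + y) + abs y] and meets [abs y] only in 0, so it is below
    [abs (x + y)]. This is what makes coordinates along disjoint sequences contractive. *)
Lemma norm_disjoint_add x y : Defs.disjoint join x y -> `|x| <= `|x + y|.
Proof.
move=> /disjointP[x0 y0 xy]; apply: norm_lef_abs.
have h : abs x <=F abs (x + y) + abs y.
  by rewrite -{1}[x](addrK y) -[abs y]absN; exact: absD.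
apply: lef_trans (lef_meet (lef_refl _) h) _.
apply: lef_trans (lef_meetD _ _ _) _ => //; try exact: abs_ge0.
rewrite -{2}[abs (x + y)]addr0; apply: lefD; first exact: lef_meetr.
by apply: xy; [exact: lef_meetl|exact: lef_meetr].
Qed.

(** * Positive parts and truncation *)

Lemma joinDr x y z : join (x + z) (y + z) = join x y + z.
Proof.
apply: lef_anti.
  by apply: join_lef; apply: lefD2r; [exact: lef_joinl|exact: lef_joinr].
by rewrite -lef_BrDr; apply: join_lef; rewrite lef_BrDr;
  [exact: lef_joinl|exact: lef_joinr].
Qed.

Lemma joinC x y : join x y = join y x.
Proof.
by apply: lef_anti; apply: join_lef; (exact: lef_joinl || exact: lef_joinr).
Qed.

Lemma posBneg x : join x 0 - join (- x) 0 = x.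
Proof.
by have := joinDr (- x) 0 x; rewrite addNr add0r joinC => ->; rewrite addrAC subrr add0r.
Qed.

Lemma lef_pos x y : x <=F y -> join x 0 <=F join y 0.
Proof.
move=> xy; apply: join_lef; last exact: lef_joinr.
exact: lef_trans xy (lef_joinl _ _).
Qed.

Lemma subr_pos a t : a - join (a - t) 0 = meet a t.
Proof.
rewrite /lmeet -[LHS]opprB; congr (- _).
by rewrite -joinDr add0r addrAC subrr add0r joinC.
Qed.

(** For [t >= 0] this is [g] minus its clipping to the interval [[-t, t]]. *)
Definition truncation g t := join (join g 0 - t) 0 - join (join (- g) 0 - t) 0.

Lemma pos_lef_abs g : join g 0 <=F abs g.
Proof. by apply: join_lef; [exact: lef_abs|exact: abs_ge0]. Qed.

Lemma abs_truncation g t : abs (truncation g t) <=F 2 *: join (abs g - t) 0.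
Proof.
have gt1 : join (join g 0 - t) 0 <=F join (abs g - t) 0.
  by apply: lef_pos; apply: lefD2r; exact: pos_lef_abs.
have gt2 : join (join (- g) 0 - t) 0 <=F join (abs g - t) 0.
  by apply: lef_pos; apply: lefD2r; rewrite -absN; exact: pos_lef_abs.
apply: lef_trans (absD _ _) _.
rewrite absN (abs_id (lef_joinr _ _)) (abs_id (lef_joinr _ _)).
by rewrite scaler_nat mulr2n; exact: lefD.
Qed.

Lemma norm_sub_truncation g t : 0 <=F t ->
  `|g - truncation g t| <= 2 * `|meet (abs g) t|.
Proof.
move=> t0; rewrite -{1}(posBneg g) /truncation subrACA !subr_pos.
apply: le_trans (ler_normB _ _) _; rewrite mulrDl mul1r; apply: lerD.
  apply: norm_lef; first by apply: meet_ge0 => //; exact: lef_joinr.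
  by apply: lef_meet2; [exact: pos_lef_abs|exact: lef_refl].
apply: norm_lef; first by apply: meet_ge0 => //; exact: lef_joinr.
by apply: lef_meet2; [rewrite -absN; exact: pos_lef_abs|exact: lef_refl].
Qed.

(** The two truncations are dominated by multiples of the positive and the negative part of the
    single element [abs g - c *: abs g']. *)
Lemma disjoint_truncation (c : R) g t g' t' : 0 < c ->
  c *: abs g' <=F t -> c^-1 *: abs g <=F t' ->
  Defs.disjoint join (truncation g t) (truncation g' t').
Proof.
move=> c0 gt gt'; apply/disjointP.
pose z := abs g - c *: abs g'.
have ic0 : 0 <= c^-1 by rewrite invr_ge0 ltW.
have h1 : abs (truncation g t) <=F 2 *: join z 0.
  apply: lef_trans (abs_truncation _ _) _; apply: lefZ => //; apply: lef_pos.
  by apply: lefD; [exact: lef_refl|exact: lefN].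
have h2 : abs (truncation g' t') <=F (2 * c^-1) *: join (- z) 0.
  apply: lef_trans (abs_truncation _ _) _; rewrite -scalerA; apply: lefZ => //.
  apply: join_lef; last by apply: lef_scale_ge0 => //; exact: lef_joinr.
  apply: (@lef_trans (c^-1 *: (- z))); last by apply: lefZ => //; exact: lef_joinl.
  rewrite /z opprB scalerBr scalerA mulVf ?gt_eqF// scale1r.
  by apply: lefD; [exact: lef_refl|exact: lefN].
apply: (pdisj_le _ _ h1 h2); try exact: abs_ge0.
apply: pdisjZ; first by rewrite mulr_ge0.
by apply: pdisjC; apply: pdisjZ => //; apply: pdisjC; exact: pdisj_pos.
Qed.

End NormedLattice.

(** * Order continuity *)

Section Halving.
Variable R : realType.

Lemma half_expS n : 2 * (2^-1 : R) ^+ n.+1 = 2^-1 ^+ n.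
Proof. by rewrite exprS mulrA mulfV ?mul1r// pnatr_eq0. Qed.

Lemma half_exp_gt0 n : 0 < (2^-1 : R) ^+ n.
Proof. by rewrite exprn_gt0// invr_gt0. Qed.

Lemma sum_half_exp K n : \sum_(K <= k < n) (2^-1 : R) ^+ k <= 2 * 2^-1 ^+ K.
Proof.
have [nK|/ltnW Kn] := leqP n K.
  by rewrite big_geq// mulr_ge0// ltW// half_exp_gt0.
suff -> : \sum_(K <= k < n) (2^-1 : R) ^+ k = 2 * 2^-1 ^+ K - 2 * 2^-1 ^+ n.
  by rewrite gerBl mulr_ge0// ltW// half_exp_gt0.
rewrite -(subnKC Kn); elim: (n - K)%N => [|m IH].
  by rewrite addn0 big_geq// subrr.
rewrite addnS big_nat_recr/= ?leq_addr// IH.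
have := half_expS (K + m); lra.
Qed.

Lemma half_exp_lt (e : R) : 0 < e -> exists N, forall n, (N <= n)%N -> (2^-1 : R) ^+ n < e.
Proof.
move=> e0; have [N eN] : exists n : nat, e^-1 < n.+1%:R.
  by exists (Num.truncn e^-1); exact: truncnS_gt.
exists N.+1 => n Nn; rewrite exprVn -[e]invrK ltf_pV2 ?posrE ?exprn_gt0 ?invr_gt0//.
apply: lt_trans eN _; rewrite -natrX ltr_nat.
exact: leq_ltn_trans Nn (ltn_expl _ _).
Qed.

End Halving.

Lemma prefix_choice (T : Type) (P : seq T -> T -> Prop) :
  (forall l, exists y, P l y) -> exists y : nat -> T, forall k, P (mkseq y k) (y k).
Proof.
move=> /choice[f Pf].
pose pre := fix pre k := if k is k'.+1 then rcons (pre k') (f (pre k')) else [::].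
exists (fun k => f (pre k)) => k.
suff -> : mkseq (fun k => f (pre k)) k = pre k by exact: Pf.
by elim: k => [//|k IH]; rewrite mkseqS IH.
Qed.

Lemma cauchy_norm_limit (R : realType) (F : completeNormedModType R) (s : nat -> F) :
  (forall e : R, 0 < e -> exists N, forall n, (N <= n)%N -> `|s N - s n| < e) ->
  exists v, forall e : R, 0 < e -> exists N, forall n, (N <= n)%N -> `|v - s n| < e.
Proof.
move=> sC; have /cauchy_cvgP/cvg_ex[v sv] : cauchy (s @ \oo)%classic.
  apply: cauchy_exP => e e0; have [N sN] := sC e e0.
  by exists (s N); exists N => // n /= Nn; rewrite -ball_normE; exact: sN.
exists v => e e0; have /cvgrPdist_lt/(_ e e0)[N _ sN] := sv.
by exists N => n Nn; exact: sN.
Qed.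

(** * Positive norming functionals and monotone sequences *)

Section OrderContinuous.
Variables (R : realType) (F : completeNormedModType R).
Variables (le : F -> F -> Prop) (join : F -> F -> F).
Hypothesis HF : is_normed_lattice le join.

Local Notation "x <=F y" := (le x y) (at level 70).
Local Notation meet := (lmeet join).
Local Notation abs := (labs join).
Local Notation lef_refl := (lef_refl HF).
Local Notation lef_trans := (lef_trans HF).

Definition positive_contraction (psi : F -> R) : Prop :=
  [/\ (forall x y, psi (x + y) = psi x + psi y),
      (forall x, 0 <=F x -> 0 <= psi x) &
      (forall x, psi x <= `|x|)].

(** Hahn-Banach is applied to the norm of the positive part: it vanishes on negative elements, which
    forces positivity, and equals the norm on positive ones. *)
Lemma positive_norming z :
  exists2 psi, positive_contraction psi & (0 <=F z -> psi z = `|z|).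
Proof.
pose p x := `|join x 0|.
have p0 x : 0 <=F join x 0 by exact: lef_joinr HF _ _.
have sp : sublinear p.
  split=> [x y|s x s0].
    apply: le_trans (ler_normD _ _); apply: (norm_lef HF); first exact: p0.
    apply: (join_lef HF); last by apply: (lef_addge0 HF); exact: p0.
    by apply: (lefD HF); exact: lef_joinl HF _ _.
  rewrite /p -{2}(ger0_norm (ltW s0)) -normrZ; apply: (norm_lef HF); first exact: p0.
  apply: (join_lef HF); last by apply: (lef_scale_ge0 HF (ltW s0)); exact: p0.
  by apply: (lefZ HF (ltW s0)); exact: lef_joinl HF _ _.
have join_id x : 0 <=F x -> join x 0 = x.
  move=> x0; apply: (lef_anti HF); last exact: lef_joinl HF _ _.
  by apply: (join_lef HF) => //; exact: lef_refl.
have [psi [psiD psip psiz]] := sublinear_additive_minorant z sp.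
exists psi => [|z0]; last by rewrite psiz /p join_id.
split=> // x.
- move=> x0; have psi0 : psi 0 = 0 by have := psiD 0 0; rewrite addr0; lra.
  have : psi (- x) <= 0.
    apply: le_trans (psip _) _; rewrite /p (joinC HF).
    suff -> : join 0 (- x) = 0 by rewrite normr0.
    apply: (lef_anti HF); last exact: lef_joinl HF _ _.
    apply: (join_lef HF); first exact: lef_refl.
    by rewrite -(lefNr HF) opprK.
  by have := psiD x (- x); rewrite subrr psi0; lra.
- apply: le_trans (psip x) _; rewrite -(norm_abs HF x).
  by apply: (norm_lef HF); [exact: p0|exact: pos_lef_abs HF _].
Qed.

Section PositiveContraction.
Variable psi : F -> R.
Hypothesis hpsi : positive_contraction psi.

Lemma positive_contraction0 : psi 0 = 0.
Proof. by case: hpsi => psiD _ _; have := psiD 0 0; rewrite addr0; lra. Qed.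

Lemma positive_contractionB x y : psi (x - y) = psi x - psi y.
Proof. by case: hpsi => psiD _ _; have := psiD (x - y) y; rewrite subrK; lra. Qed.

Lemma positive_contraction_le x y : x <=F y -> psi x <= psi y.
Proof.
case: hpsi => _ psi0 _; rewrite -(lef_subge0 HF) => /psi0.
by rewrite positive_contractionB subr_ge0.
Qed.

Lemma positive_contraction_sum I (s : seq I) (P : pred I) (G : I -> F) :
  psi (\sum_(i <- s | P i) G i) = \sum_(i <- s | P i) psi (G i).
Proof.
case: hpsi => psiD _ _.
by rewrite (big_morph psi psiD positive_contraction0).
Qed.

End PositiveContraction.

Hypothesis Hoc : order_continuous le.

Lemma decreasing_cauchy (x : nat -> F) :
  (forall n, 0 <=F x n) -> (forall n m, (n <= m)%N -> x m <=F x n) ->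
  forall e : R, 0 < e -> exists N, forall n, (N <= n)%N -> `|x N - x n| < e.
Proof.
move=> x0 xdec e e0.
(* Subtracting all lower bounds gives a net decreasing to 0, even though the
   infimum of the sequence is not known to exist. *)
pose D := (nat * {l | forall n, l <=F x n})%type.
pose ord (p q : D) := (p.1 <= q.1)%N /\ sval p.2 <=F sval q.2.
have [| | | |[N [l lx]] Nl] := Hoc (D := D) (ord := ord)
    (x := fun p => x p.1 - sval p.2) _ _ _ _ e0.
- split; first by constructor; exact: (0, exist _ 0 x0).
  split; first by move=> p; split=> //; exact: lef_refl.
  split.
    move=> p q r [pq1 pq2] [qr1 qr2]; split; first exact: leq_trans qr1.
    exact: lef_trans pq2 qr2.
  move=> [n [a ax]] [m [b bx]].
  have jx k : join a b <=F x k by exact: join_lef HF _ _ _ _ _.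
  exists (maxn n m, exist _ (join a b) jx); split; split => /=.
  + exact: leq_maxl.
  + exact: lef_joinl HF _ _.
  + exact: leq_maxr.
  + exact: lef_joinr HF _ _.
- move=> p q [pq1 pq2]; apply: (lefD HF); first exact: xdec.
  exact: (lefN HF).
- by move=> [n [a ax]] /=; rewrite (lef_subge0 HF).
(* If [g *+ k] is below every [x n], it is itself a second component of an index, so the bound at
   that index gives the same for [g *+ k.+1]. Hence all multiples of [g] are below [x 0]. *)
- move=> g gx; apply: (lef_archimedean HF (v := x 0)) => k.
  suff /(_ 0) : forall n, g *+ k <=F x n by [].
  elim: k => [|k IH] n; first by rewrite mulr0n.
  have /= := gx (n, exist _ _ IH).
  by rewrite (lef_BrDr HF) mulrS.
- exists N => n Nn.
  have := Nl (N, exist _ l lx) (conj (leqnn N) (lef_refl l)); rewrite normr_id.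
  apply: le_lt_trans.
  apply: (norm_lef HF); first by rewrite (lef_subge0 HF); exact: xdec.
  by apply: (lefD HF); [exact: lef_refl|apply: (lefN HF)].
Qed.

Lemma increasing_bounded_limit (s : nat -> F) h :
  (forall n, s n <=F h) -> (forall n m, (n <= m)%N -> s n <=F s m) ->
  exists v, forall e : R, 0 < e -> exists N, forall n, (N <= n)%N -> `|v - s n| < e.
Proof.
move=> sh sinc; apply: cauchy_norm_limit => e e0.
have [| |N sN] := @decreasing_cauchy (fun n => h - s n) _ _ e e0.
- by move=> n; rewrite (lef_subge0 HF).
- move=> n m nm; apply: (lefD HF); first exact: lef_refl.
  by apply: (lefN HF); exact: sinc.
- exists N => n /sN; rewrite subrACA subrr sub0r normrN; exact.
Qed.

End OrderContinuous.

(** * Disjoint elements of order intervals *)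

Section DisjointSequences.
Variables (R : realType) (F : completeNormedModType R).
Variables (le : F -> F -> Prop) (join : F -> F -> F).
Hypotheses (HF : is_normed_lattice le join) (Hoc : order_continuous le).

Local Notation "x <=F y" := (le x y) (at level 70).
Local Notation meet := (lmeet join).
Local Notation abs := (labs join).
Local Notation lef_refl := (lef_refl HF).
Local Notation lef_trans := (lef_trans HF).
Local Notation contraction := (positive_contraction le).

(** Pigeonhole: disjoint elements below [h] have their sum below [h], so the values of the
    functional [\sum_i psi i] on them add up to at most its value at [h]. With more than that value
    divided by [d] elements, one has value at most [d]. *)
Lemma pdisj_tuple_selection (h : F) (e d : R) (I : finType) (psi : I -> F -> R) :
  0 <=F h -> 0 < d -> (forall i, contraction (psi i)) ->
  (forall n, exists x : 'I_n -> F, [/\ (forall i j, i != j -> pdisj le (x i) (x j)),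
    (forall i, 0 <=F x i), (forall i, x i <=F h) & (forall i, e <= `|x i|)]) ->
  exists y, [/\ 0 <=F y, y <=F h, e <= `|y| & forall i, psi i y <= d].
Proof.
move=> h0 d0 psiP; pose n := (Num.truncn ((\sum_i psi i h) / d)).+1.
move=> /(_ n)[x [xx x0 xh ex]].
pose Psi z := \sum_i psi i z.
have Psi_le a b : a <=F b -> Psi a <= Psi b.
  by move=> ab; apply: ler_sum => i _; exact: positive_contraction_le HF _ (psiP i) _ _ ab.
have [k Pk] : exists k, Psi (x k) <= d.
  apply: contrapT => /forallNP H.
  have : \sum_(k < n) d <= \sum_k Psi (x k).
    by apply: ler_sum => k _; rewrite ltW// ltNge; apply/negP; exact: H.
  rewrite exchange_big/=.
  have -> : \sum_i \sum_k psi i (x k) = Psi (\sum_k x k).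
    by apply: eq_bigr => i _; rewrite (positive_contraction_sum (psiP i)).
  have := Psi_le _ _ (sum_pdisj_le HF xx x0 xh h0).
  rewrite sumr_const card_ord -mulr_natr => Pxh dPx.
  have := truncnS_gt (Psi h / d); rewrite ltr_pdivrMr// mulrC -/n.
  by rewrite ltNge (le_trans dPx).
exists (x k); split => // i; apply: le_trans Pk; rewrite /Psi (bigD1 i)//= lerDl.
by apply: sumr_ge0 => j _; case: (psiP j) => _ /(_ _ (x0 k)).
Qed.

(* Otherwise choose [y_k] with [|y_k| >= e] such that the norming functionals of the
   earlier terms are at most [2^-k] at [y_k].  The suprema of the tails of [y],
   here replaced by [lim_L (h /\ \sum_(K <= k < L) y_k)], decrease, hence are Cauchy,
   whereas the norming functional of [y_K] is at least [e] at the K-th one and tends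
   to 0 along the sequence. *)
Lemma uniform_exhaustion h (e : R) : 0 <=F h -> 0 < e ->
  exists n : nat, forall x : 'I_n -> F,
    (forall i j, i != j -> pdisj le (x i) (x j)) ->
    (forall i, 0 <=F x i) -> (forall i, x i <=F h) -> exists i, `|x i| < e.
Proof.
move=> h0 e0; apply: contrapT => /forallNP H.
have {}H n : exists x : 'I_n -> F, [/\ (forall i j, i != j -> pdisj le (x i) (x j)),
    (forall i, 0 <=F x i), (forall i, x i <=F h) & (forall i, e <= `|x i|)].
  have /existsNP[x /not_implyP[xx /not_implyP[x0 /not_implyP[xh /forallNP ex]]]] := H n.
  exists x.
  by split=> // i; rewrite leNgt; apply/negP; exact: ex.
have /choice[psi psiP] (z : F) : exists psi : F -> R,
    contraction psi /\ (0 <=F z -> psi z = `|z|).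
  by have [psi] := positive_norming HF z; exists psi.
have psiC z := (psiP z).1.
pose P (l : seq F) y := [/\ 0 <=F y, y <=F h, e <= `|y| &
  forall z, z \in l -> psi z y <= 2^-1 ^+ size l].
have [l|y yP] := @prefix_choice F P.
  have [y [y0 yh ey yl]] := @pdisj_tuple_selection h e (2^-1 ^+ size l)
    'I_(size l) (fun i => psi (tnth (in_tuple l) i)) h0 (half_exp_gt0 _ _)
    (fun i => psiC _) H.
  exists y; split=> // z /(nthP 0)[i il <-].
  by have := yl (Ordinal il); rewrite (tnth_nth 0).
have y0 k : 0 <=F y k by case: (yP k).
have yh k : y k <=F h by case: (yP k).
have ey k : e <= `|y k| by case: (yP k).
have psiy m k : (m < k)%N -> psi (y m) (y k) <= 2^-1 ^+ k.
  move=> mk; case: (yP k) => _ _ _; rewrite size_mkseq; apply.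
  by apply/mapP; exists m => //; rewrite mem_iota.
pose S K L := meet h (\sum_(K <= k < L) y k).
have sumy0 K L : 0 <=F \sum_(K <= k < L) y k by exact: (lef_sum_ge0 HF).
have sum_mono K K' L L' : (K' <= K)%N -> (L <= L')%N ->
    \sum_(K <= k < L) y k <=F \sum_(K' <= k < L') y k.
  move=> KK LL; have [LK|/ltnW KL] := leqP L K.
    by rewrite big_geq//; exact: sumy0.
  rewrite (big_cat_nat KK (leq_trans KL LL)) (big_cat_nat KL LL)/=.
  apply: lef_trans (lef_addr HF _ (sumy0 _ _)).
  exact: (lef_addl HF).
have S_mono K K' L L' : (K' <= K)%N -> (L <= L')%N -> S K L <=F S K' L'.
  by move=> KK LL; apply: (lef_meet2 HF); [exact: lef_refl|exact: sum_mono].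
have S0 K L : 0 <=F S K L.
  by apply: (meet_ge0 HF) => //; exact: sumy0.
have /choice[v vP] K : exists v : F, forall d : R, 0 < d ->
    exists N, forall n, (N <= n)%N -> `|v - S K n| < d.
  apply: (increasing_bounded_limit HF Hoc (h := h)).
    by move=> n; exact: lef_meetl HF _ _.
  by move=> n m nm; exact: S_mono.
have Sv K L : S K L <=F v K.
  apply: (lef_approx HF) => d d0; have [N vN] := vP K d d0.
  exists (S K L), (S K (maxn N L)); split.
  - by apply: S_mono => //; exact: leq_maxr.
  - by rewrite subrr normr0.
  - by apply: vN; exact: leq_maxl.
have v_dec n m : (n <= m)%N -> v m <=F v n.
  move=> nm; apply: (lef_approx HF) => d d0.
  have [N vN] := vP m d d0; have [N' vN'] := vP n d d0.
  exists (S m (maxn N N')), (S n (maxn N N')); split.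
  - exact: S_mono.
  - by apply: vN; exact: leq_maxl.
  - by apply: vN'; exact: leq_maxr.
have v0 n : 0 <=F v n by exact: lef_trans (S0 n 0) (Sv _ _).
have [|N vN] := decreasing_cauchy HF Hoc v0 v_dec (e := e / 2); first lra.
have yv : y N <=F v N.
  apply: lef_trans (Sv N N.+1); apply: (lef_meet HF) => //.
  by rewrite big_nat1; exact: lef_refl.
have psivN : e <= psi (y N) (v N).
  apply: le_trans (positive_contraction_le HF (psiC (y N)) yv).
  by rewrite (psiP (y N)).2.
(* [v n] is close to [S n M], which lies below a tail sum of [y]; there the functional is bounded by
   a geometric sum. *)
have psiv n : (N < n)%N -> psi (y N) (v n) <= 2 * 2^-1 ^+ n.
  move=> Nn; apply/ler_addgt0Pr => d d0; have [M vM] := vP n d d0.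
  have := vM _ (leqnn M).
  have [_ _ /(_ (v n - S n M))] := psiC (y N).
  rewrite (positive_contractionB (psiC _)).
  have := positive_contraction_le HF (psiC (y N)) (lef_meetr HF h (\sum_(n <= k < M) y k)).
  rewrite (positive_contraction_sum (psiC _)) -/(S n M).
  have : \sum_(n <= i < M) psi (y N) (y i) <= \sum_(n <= i < M) 2^-1 ^+ i.
    by rewrite big_nat [leRHS]big_nat; apply: ler_sum => i /andP[ni _];
      apply: psiy; exact: leq_trans ni.
  have := sum_half_exp R n M; lra.
(* Then the functional is below [e / 2] at [v n], while [v N - v n] has norm below [e / 2]; this
   contradicts the value at least [e] at [v N]. *)
have [|M eM] := @half_exp_lt R (e / 4); first lra.
pose n := maxn M N.+1.
have := eM n (leq_maxl _ _); have := psiv n (leq_maxr _ _).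
have := vN n (ltnW (leq_maxr _ _)).
have [_ _ /(_ (v N - v n))] := psiC (y N); rewrite (positive_contractionB (psiC _)).
lra.
Qed.

(** Otherwise infinitely many terms have a meet with [h] of norm at least [e], and these meets give
    arbitrarily long disjoint tuples below [h]. *)
Lemma disjoint_seq_un_null (f : nat -> F) h (e : R) : disjoint_seq join f ->
  0 <=F h -> 0 < e -> exists N, forall n, (N <= n)%N -> `|meet (abs (f n)) h| < e.
Proof.
move=> ff h0 e0; have [n nP] := uniform_exhaustion h0 e0.
apply: contrapT => /forallNP H.
have {}H N : exists k, (N <= k)%N /\ e <= `|meet (abs (f k)) h|.
  have /existsNP[k /not_implyP[Nk /negP]] := H N.
  by rewrite -leNgt => ek; exists k.
have /choice[s sP] := H.
pose k := fix k i := if i is i'.+1 then s (k i').+1 else s 0.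
have k_inc i j : (i < j)%N -> (k i < k j)%N.
  elim: j => // j IH; rewrite ltnS leq_eqVlt => /predU1P[->|/IH ij].
    exact: (sP _).1.
  exact: ltn_trans ij (sP _).1.
have ek i : e <= `|meet (abs (f (k i))) h| by case: i => [|i]; exact: (sP _).2.
have m0 i : 0 <=F meet (abs (f i)) h by apply: (meet_ge0 HF) => //; exact: abs_ge0 HF _.
have [||i|i] := nP (fun i => meet (abs (f (k i))) h).
- move=> i j ij; apply: (pdisj_le HF); rewrite ?m0//.
  + exact: lef_meetl HF _ _.
  + exact: lef_meetl HF _ _.
  + apply/(disjointP HF); apply: ff => kij; move/negP: ij; apply.
    apply/eqP/val_inj; have [/k_inc|/k_inc|//] := ltngtP i j; rewrite kij ltnn//.
- by move=> i.
- exact: lef_meetr HF _ _.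
- by rewrite ltNge ek.
Qed.

End DisjointSequences.

(** * Disjoint perturbations *)

Section Perturbation.
Variables (R : realType) (F : completeNormedModType R).
Variables (le : F -> F -> Prop) (join : F -> F -> F).
Hypotheses (HF : is_normed_lattice le join).
Variables (H : normedModType R) (T : {linear F -> H}) (C : R).
Hypotheses (C0 : 0 <= C) (TC : forall x : F, `|T x| <= C * `|x|).

Local Notation "x <=F y" := (le x y) (at level 70).
Local Notation meet := (lmeet join).
Local Notation abs := (labs join).
Local Notation lef_refl := (lef_refl HF).
Local Notation lef_trans := (lef_trans HF).

(** [t m] is the sum of [(b * 2^-1 ^+ k) *: abs (g k)] over [k > m]; starting at [m + 1] absorbs the
    factor 2 of the geometric sum. *)
Lemma dominated_tail (g : nat -> F) (b : R) : 0 < b -> (forall k, `|g k| = 1) ->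
  exists t : nat -> F, forall m,
    [/\ 0 <=F t m, `|t m| <= b * 2^-1 ^+ m &
        forall k, (m < k)%N -> (b * 2^-1 ^+ k) *: abs (g k) <=F t m].
Proof.
move=> b0 g1; pose u k := (b * 2^-1 ^+ k) *: abs (g k).
have bk0 k : 0 <= b * 2^-1 ^+ k by rewrite mulr_ge0// ltW// half_exp_gt0.
have u0 k : 0 <=F u k by apply: (lef_scale_ge0 HF) => //; exact: abs_ge0 HF _.
have nu k : `|u k| = b * 2^-1 ^+ k.
  by rewrite normrZ (norm_abs HF) g1 mulr1 ger0_norm.
have nsum m n : `|\sum_(m <= k < n) u k| <= 2 * (b * 2^-1 ^+ m).
  apply: le_trans (ler_norm_sum _ _ _) _.
  under eq_bigr do rewrite nu.
  rewrite -mulr_sumr mulrCA ler_pM2l//; exact: sum_half_exp.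
pose S n := \sum_(0 <= k < n) u k.
have SB m n : (m <= n)%N -> S n - S m = \sum_(m <= k < n) u k.
  by move=> mn; rewrite /S (big_cat_nat (leq0n m) mn)/= addrAC subrr add0r.
have [e e0|s sP] := @cauchy_norm_limit R F S.
  have [|N NP] := @half_exp_lt R (e / (2 * b)); first by rewrite divr_gt0// mulr_gt0.
  exists N => n Nn; rewrite distrC SB//; apply: le_lt_trans (nsum _ _) _.
  by have := NP N (leqnn N); rewrite ltr_pdivlMr ?mulr_gt0// mulrC mulrA.
have tP m k : (m < k)%N -> u k <=F s - S m.+1.
  move=> mk; apply: (lef_approx HF) => e e0; have [N sN] := sP e e0.
  exists (u k), (S (maxn N k.+1) - S m.+1).
  have kM : (k < maxn N k.+1)%N by exact: leq_maxr.
  rewrite SB; last by apply: (leq_trans mk); exact: ltnW.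
  split; last 2 first.
  - by rewrite subrr normr0.
  - rewrite -SB; last by apply: (leq_trans mk); exact: ltnW.
    by rewrite subrACA subrr subr0; apply: sN; exact: leq_maxl.
  by apply: (lef_big HF) => //; rewrite mem_index_iota mk.
exists (fun m => s - S m.+1) => m; split; last by move=> k; exact: tP.
  exact: lef_trans (u0 m.+1) (tP _ _ (ltnSn m)).
apply/ler_addgt0Pr => e e0; have [N sN] := sP e e0.
pose M := maxn N m.+1.
have := sN M (leq_maxl _ _); have := nsum m.+1 M.
rewrite mulrCA half_expS -SB ?leq_maxr//.
have := ler_normD (s - S M) (S M - S m.+1); rewrite addrA subrK; lra.
Qed.

(* Kadec-Pelczynski: choosing [g_m] almost disjoint from a large multiple of
   [|g_0| + ... + |g_(m-1)|], truncate each [g_m] by that multiple plus small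
   multiples of all later [|g_k|]. *)
Lemma almost_disjoint_to_disjoint :
  (forall (e : R) h, 0 < e -> 0 <=F h ->
    exists g, [/\ `|g| = 1, `|T g| < e & `|meet (abs g) h| < e]) ->
  exists f : nat -> F, [/\ disjoint_seq join f, (forall m, `|f m| = 1) &
    forall m, `|T (f m)| <= 2^-1 ^+ m].
Proof.
move=> small; have C0' := C0.
(* The constant makes [4 * b m <= 1/2], so that truncation leaves norm at least 1/2, and
   [b m * (1 + 4 * C)] at most half of [2^-m]; normalisation then costs only a factor 2. *)
pose kap : R := (8 * (1 + C))^-1; pose b m : R := kap * 2^-1 ^+ m.
have c8 : 0 < 8 * (1 + C) by rewrite mulr_gt0//; lra.
have kap0 : 0 < kap by rewrite invr_gt0.
have kapC : kap * (8 * (1 + C)) = 1 by rewrite mulVf ?gt_eqF.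
have b0 m : 0 < b m by rewrite mulr_gt0// half_exp_gt0.
pose past (l : seq F) := (b (size l))^-1 *: \sum_(z <- l) abs z.
have past0 l : 0 <=F past l.
  apply: (lef_scale_ge0 HF); first by rewrite invr_ge0 ltW.
  by apply: (lef_sum_ge0 HF) => i _; exact: abs_ge0 HF _.
have [l|g gP] := @prefix_choice F (fun l g => [/\ `|g| = 1,
    `|T g| < b (size l) & `|meet (abs g) (past l)| < b (size l)]).
  exact: small.
have g1 m : `|g m| = 1 by case: (gP m).
have [tail tailP] := dominated_tail kap0 g1.
pose t m := past (mkseq g m) + tail m.
have t0 m : 0 <=F t m by apply: (lef_addge0 HF) => //; case: (tailP m).
pose f m := truncation join (g m) (t m).
have gf m : `|g m - f m| <= 4 * b m.
  apply: le_trans (norm_sub_truncation HF _ (t0 m)) _.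
  have [tl0 tlb _] := tailP m.
  suff : `|meet (abs (g m)) (t m)| <= 2 * b m by lra.
  have [_ _] := gP m; rewrite size_mkseq => mp.
  apply: (@le_trans _ _ `|meet (abs (g m)) (past (mkseq g m)) + tail m|).
    apply: (norm_lef HF); first by apply: (meet_ge0 HF) => //; exact: abs_ge0 HF _.
    exact: (lef_meetDr HF).
  apply: le_trans (ler_normD _ _) _; rewrite -/(b m) in tlb; lra.
have bk m : b m <= kap.
  rewrite /b -[leRHS]mulr1 ler_pM2l// exprn_ile1// ?invr_ge0// invf_le1//; lra.
have kap8 : 8 * kap <= 1.
  have : 0 <= kap * C by rewrite mulr_ge0// ltW.
  move: kapC; rewrite mulrCA mulrDr mulr1 mulrDr; lra.
have f1 m : 2^-1 <= `|f m|.
  have := ler_normD (g m - f m) (f m); rewrite subrK g1.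
  have := gf m; have := bk m; lra.
have Tf m : `|T (f m)| <= b m * (1 + 4 * C).
  have -> : T (f m) = T (g m) - T (g m - f m) by rewrite -linearB subKr.
  apply: le_trans (ler_normB _ _) _.
  have [_ Tg _] := gP m; rewrite size_mkseq in Tg.
  have : C * `|g m - f m| <= C * (4 * b m) by rewrite ler_wpM2l.
  have -> : b m * (1 + 4 * C) = b m + C * (4 * b m) by ring.
  by have := TC (g m - f m); move: Tg; lra.
have fpos m : 0 < `|f m| by apply: lt_le_trans (f1 m); rewrite invr_gt0.
(* The ratio is [c = (b l)^-1]: the past part of [t l] dominates [c *: abs (g m)], and the tail part
   of [t m] dominates [c^-1 *: abs (g l)]. *)
have ff m l : (m < l)%N -> Defs.disjoint join (f l) (f m).
  move=> ml; have bl0 : 0 < (b l)^-1 by rewrite invr_gt0.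
  apply: (disjoint_truncation HF bl0).
    have [tl0 _ _] := tailP l.
    apply: lef_trans (lef_addl HF _ tl0); rewrite /past size_mkseq.
    apply: (lefZ HF); first exact: ltW.
    apply: (lef_big HF (G := abs)); first by move=> z; exact: abs_ge0 HF _.
    by apply/mapP; exists m => //; rewrite mem_iota.
  rewrite invrK; have [_ _ /(_ l ml) tl] := tailP m.
  exact: lef_trans tl (lef_addr HF _ (past0 _)).
have scaled m l : Defs.disjoint join (f m) (f l) ->
    Defs.disjoint join (`|f m|^-1 *: f m) (`|f l|^-1 *: f l).
  move=> ml; apply: (disjoint_scaler HF); apply: (disjointC HF).
  by apply: (disjoint_scaler HF); exact: disjointC HF _ _ ml.
exists (fun m => `|f m|^-1 *: f m); split.
- move=> m l; case: (ltngtP m l) => // [ml|lm] _; apply: scaled.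
    by apply: (disjointC HF); exact: ff.
  exact: ff.
- by move=> m; rewrite normrZ ger0_norm ?invr_ge0// mulVf// gt_eqF.
- move=> m; rewrite linearZ normrZ ger0_norm ?invr_ge0// mulrC ler_pdivrMr//.
  apply: le_trans (Tf m) _.
  apply: (@le_trans _ _ (2^-1 ^+ m * 2^-1)); last first.
    by rewrite ler_pM2l ?half_exp_gt0.
  rewrite /b mulrAC mulrC ler_pM2l ?half_exp_gt0//.
  have -> : kap * (1 + 4 * C) = 2^-1 * (kap * (8 * (1 + C))) - 3 * kap by field.
  rewrite kapC; move: kap0; lra.
Qed.

End Perturbation.

(** * Strict singularity on the span of a disjoint sequence *)

Section SmallOnDisjoint.
Variables (R : realType) (F : completeNormedModType R).
Variables (le : F -> F -> Prop) (join : F -> F -> F).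
Hypotheses (HF : is_normed_lattice le join).
Variables (H : normedModType R) (T : {linear F -> H}) (C : R).
Hypotheses (C0 : 0 <= C) (TC : forall x : F, `|T x| <= C * `|x|).
Variable f : nat -> F.
Hypotheses (fd : disjoint_seq join f) (f1 : forall m, `|f m| = 1).

Lemma coefficient_le_norm (b : nat -> R) n k : (k < n)%N ->
  `|b k| <= `|\sum_(0 <= i < n) b i *: f i|.
Proof.
move=> kn; have -> : `|b k| = `|b k *: f k| by rewrite normrZ f1 mulr1.
rewrite (bigD1_seq k) ?mem_index_iota ?iota_uniq//=.
apply: (norm_disjoint_add HF); apply: (disjoint_sumr HF) => i ik.
apply: (disjoint_scaler HF); apply: (disjointC HF); apply: (disjoint_scaler HF).
by apply: fd; exact/eqP.
Qed.

(** Padding by zeros brings combinations of different lengths to a common one. *)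
Lemma sum_cut (c : nat -> R) (g : nat -> F) p q : (p <= q)%N ->
  \sum_(0 <= i < q) (if (i < p)%N then c i else 0) *: g i =
  \sum_(0 <= i < p) c i *: g i.
Proof.
move=> pq; rewrite (big_cat_nat (leq0n p) pq)/=.
have -> : \sum_(p <= i < q) (if (i < p)%N then c i else 0) *: g i = 0.
  by rewrite big_nat big1// => i /andP[pi _]; rewrite ltnNge pi/= scale0r.
by rewrite addr0; apply: eq_big_nat => i /andP[_ ip]; rewrite ip.
Qed.

(* The inf-convolution of the coordinate [b |-> b k] with the norm; it extends the
   coordinate to all of [F] without any completeness argument. *)
Lemma coordinate_extension (x : F) k : exists a : R, forall b n, (k < n)%N ->
  `|a - b k| <= `|x - \sum_(0 <= i < n) b i *: f i|.
Proof.
pose E := [set r | exists (b : nat -> R) (n : nat), (k < n)%N /\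
  r = b k + `|x - \sum_(0 <= i < n) b i *: f i|]%classic.
have E_lb b n : (k < n)%N -> lbound E (b k - `|x - \sum_(0 <= i < n) b i *: f i|).
  move=> kn _ [b' [n' [kn' ->]]].
  pose cut (c : nat -> R) p i := if (i < p)%N then c i else 0.
  pose m := maxn n n'.
  have km : (k < m)%N by apply: leq_trans kn _; exact: leq_maxl.
  have := coefficient_le_norm (fun i => cut b n i - cut b' n' i) km.
  under [X in _ <= `|X|]eq_bigr do rewrite scalerBl.
  rewrite sumrB !sum_cut ?leq_maxl ?leq_maxr// /cut kn kn'.
  set z := \sum_(_ <= i < n) _; set z' := \sum_(_ <= i < n') _.
  have := ler_norm (b k - b' k); have := ler_normB (x - z') (x - z).
  have -> : x - z' - (x - z) = z - z' by rewrite opprB addrC addrA subrK.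
  lra.
have E0 : (E !=set0)%classic by eexists; exists (fun=> 0), k.+1; split.
exists (inf E) => b n kn; rewrite ler_norml; apply/andP; split.
  by rewrite lerBrDl; apply: lb_le_inf => //; exact: E_lb.
rewrite lerBlDl; apply: ge_inf; last by exists b, n.
by eexists; exact: (E_lb b n kn).
Qed.

(** One zero-padded coefficient sequence serves all large [n], so that finitely many vectors can be
    approximated at a common length. *)
Lemma closed_span_approx x (e : R) : closed_span f x -> 0 < e ->
  exists b n0, forall n, (n0 <= n)%N -> `|x - \sum_(0 <= i < n) b i *: f i| < e.
Proof.
move=> fx e0; have [z [[n0 [b zE]] xz]] := fx _ (nbhsx_ballx x e e0).
exists (fun i => if (i < n0)%N then b i else 0), n0 => n nn.
rewrite sum_cut// big_mkord.
by rewrite -zE; move: xz; rewrite -ball_normE.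
Qed.

Hypothesis Tf : forall m, `|T (f m)| <= 2^-1 ^+ m.

(** The first [N] terms are at most [d] each, as [T (f i)] has norm at most 1. Later coefficients
    are bounded by the norm of the whole sum, and the norms of the [T (f i)] sum geometrically. *)
Lemma norm_image_le (b : nat -> R) N n (d : R) : (N <= n)%N ->
  (forall i, (i < N)%N -> `|b i| <= d) ->
  `|T (\sum_(0 <= i < n) b i *: f i)| <=
    N%:R * d + 2 * 2^-1 ^+ N * `|\sum_(0 <= i < n) b i *: f i|.
Proof.
move=> Nn bd; set w := `|\sum_(0 <= i < n) b i *: f i|.
rewrite linear_sum/=; apply: le_trans (ler_norm_sum _ _ _) _.
under eq_bigr do rewrite linearZZ normrZ.
rewrite (big_cat_nat (leq0n N) Nn)/=; apply: lerD.
  rewrite mulr_natl -[X in d *+ X]subn0 -sumr_const_nat.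
  rewrite big_nat [leRHS]big_nat; apply: ler_sum => i /andP[_ iN].
  apply: le_trans (_ : d * 1 <= _); last by rewrite mulr1.
  apply: ler_pM => //; first exact: bd.
  by apply: le_trans (Tf i) _; rewrite exprn_ile1// ?invr_ge0// invf_le1//; lra.
apply: (@le_trans _ _ (\sum_(N <= i < n) w * 2^-1 ^+ i)).
  rewrite big_nat [leRHS]big_nat; apply: ler_sum => i /andP[_ iN].
  by apply: ler_pM => //; exact: coefficient_le_norm.
rewrite -mulr_sumr [leLHS]mulrC; apply: ler_wpM2r; first exact: normr_ge0.
exact: sum_half_exp.
Qed.

Lemma dependent_rows (m : nat) (A : 'M[R]_(m.+1, m)) :
  exists2 r : 'rV[R]_m.+1, r != 0 & r *m A = 0.
Proof.
have : kermx A != 0.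
  rewrite -mxrank_eq0 mxrank_ker -lt0n subn_gt0 ltnS; exact: rank_leq_col.
by case/rowV0Pn => r /sub_kermxP rA r0; exists r.
Qed.

(* A combination of [N + 1] independent vectors of [Y] with vanishing first [N]
   coordinates is mapped by [T] to a vector of norm at most [2 * 2^-N] times its norm. *)
Lemma small_disjoint_strictly_singular : strictly_singular_on T (closed_span f).
Proof.
move=> Y Ysub Yf Yinf [c [c0 Yc]].
have [|N /(_ N (leqnn N)) Nc] := @half_exp_lt R (c / 2); first lra.
have [y [Yy yfree]] := Yinf N.+1.
(* [a (i, j)] is the extended [j]-th coordinate of [y i]; with one more vector than coordinates,
   some nonzero row [r] kills all [N] of them. *)
have /choice[a aP] (p : 'I_N.+1 * 'I_N) : exists a : R, forall (b : nat -> R) n, (p.2 < n)%N ->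
    `|a - b p.2| <= `|y p.1 - \sum_(0 <= i < n) b i *: f i|.
  exact: coordinate_extension.
have [r r0 rA] := dependent_rows (\matrix_(i, j) a (i, j)).
pose v := \sum_i r 0 i *: y i.
have Yv : Y v.
  rewrite /v; elim/big_ind: _ => [|u w Yu Yw|i _]; first exact: Ysub.1.
    by rewrite -[u]scale1r; exact: Ysub.2.
  by rewrite -[_ *: _]addr0; apply: Ysub.2 => //; exact: Ysub.1.
have v0 : 0 < `|v|.
  rewrite normr_gt0; apply: contra_neq r0 => /yfree ri.
  by apply/rowP => i; rewrite ri mxE.
pose K := \sum_i `|r 0 i|.
have K0 : 0 <= K by exact: sumr_ge0.
suff : `|T v| <= 2 * 2^-1 ^+ N * `|v|.
  have : 2 * 2^-1 ^+ N * `|v| < c * `|v| by rewrite ltr_pM2r//; lra.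
  by have := Yc _ Yv; lra.
(* [M * d] collects the errors made when [v] is replaced by a finite combination [z] within [K * d];
   [1 + M] in the denominator of [d] avoids dividing by 0. *)
pose M := N%:R * K + 2 * 2^-1 ^+ N * K + C * K.
have M0 : 0 <= M.
  by rewrite !addr_ge0 ?mulr_ge0// ltW// half_exp_gt0.
apply/ler_addgt0Pr => e e0; pose d := e / (1 + M).
have M1 : 0 < 1 + M by lra.
have d0 : 0 < d by rewrite divr_gt0.
have /choice[b /choice[n0 bP]] (i : 'I_N.+1) : exists b n0, forall n, (n0 <= n)%N ->
    `|y i - \sum_(0 <= j < n) b j *: f j| < d.
  by apply: closed_span_approx => //; exact: Yf.
pose n := (N + \max_i n0 i)%N.
have n0n i : (n0 i <= n)%N by apply: leq_trans (leq_addl _ _); exact: leq_bigmax.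
pose bb j := \sum_i r 0 i * b i j.
pose z := \sum_(0 <= j < n) bb j *: f j.
have zE : z = \sum_i r 0 i *: \sum_(0 <= j < n) b i j *: f j.
  under eq_bigr do rewrite scaler_sumr.
  rewrite exchange_big/=; apply: eq_bigr => j _; rewrite scaler_suml.
  by apply: eq_bigr => i _; rewrite scalerA.
have vz : `|v - z| <= K * d.
  rewrite zE /v -sumrB mulr_suml; apply: le_trans (ler_norm_sum _ _ _) _.
  by apply: ler_sum => i _; rewrite -scalerBr normrZ ler_wpM2l// ltW// bP.
(* Since [r] kills the extended coordinates, [bb j] only carries the errors [a (i, j) - b i j]. *)
have bbd j : (j < N)%N -> `|bb j| <= K * d.
  move=> jN; have -> : bb j = - \sum_i r 0 i * (a (i, Ordinal jN) - b i j).
    under eq_bigr do rewrite mulrBr.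
    rewrite sumrB opprB -/(bb j); have /rowP/(_ (Ordinal jN)) := rA.
    by rewrite !mxE; under eq_bigr do rewrite mxE; move=> ->; rewrite subr0.
  rewrite normrN mulr_suml; apply: le_trans (ler_norm_sum _ _ _) _.
  apply: ler_sum => i _; rewrite normrM ler_wpM2l//.
  apply: le_trans (aP (i, Ordinal jN) (b i) n _) _; last by rewrite ltW// bP.
  exact: leq_trans jN (leq_addr _ _).
have Tz := norm_image_le (leq_addr (\max_i n0 i) N) bbd.
rewrite -/n -/z in Tz.
have Tv : `|T v| <= `|T z| + C * `|v - z|.
  have -> : T v = T z + T (v - z) by rewrite -linearD addrC subrK.
  by apply: le_trans (ler_normD _ _) _; rewrite lerD2l.
have zv : `|z| <= `|v| + `|v - z|.
  by have := ler_normB v (v - z); rewrite subKr.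
apply: le_trans Tv _.
have h1 : C * `|v - z| <= C * (K * d) by rewrite ler_wpM2l.
have h2 : 2 * 2^-1 ^+ N * `|z| <= 2 * 2^-1 ^+ N * (`|v| + K * d).
  apply: ler_wpM2l; last lra.
  by rewrite mulr_ge0// ltW// half_exp_gt0.
have h3 : M * d <= e.
  rewrite /d mulrCA -[leRHS]mulr1; apply: ler_wpM2l; first exact: ltW.
  by rewrite ler_pdivrMr//; lra.
have ME : M * d = N%:R * (K * d) + 2 * 2^-1 ^+ N * (K * d) + C * (K * d).
  by rewrite /M; ring.
rewrite mulrDr in h2; lra.
Qed.

End SmallOnDisjoint.

(** * The equivalences *)

Lemma cvg0_seqP (R : realType) (u : nat -> R) :
  (u @ \oo --> (0 : R))%classic <->
  forall e : R, 0 < e -> exists N, forall n, (N <= n)%N -> `|u n| < e.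
Proof.
split=> [/cvgr0Pnorm_lt u0 e e0|u0].
  by have [N _ Nu] := u0 e e0; exists N => n Nn; exact: Nu.
by apply/cvgr0Pnorm_lt => e e0; have [N Nu] := u0 e e0; exists N.
Qed.

Section DisjointlyNonSingular.
Variables (R : realType) (F : completeNormedModType R).
Variables (le : F -> F -> Prop) (join : F -> F -> F).
Hypotheses (HF : is_normed_lattice le join) (Hoc : order_continuous le).
Variables (H : normedModType R) (T : {linear F -> H}).

Local Notation "x <=F y" := (le x y) (at level 70).
Local Notation meet := (lmeet join).
Local Notation abs := (labs join).

(** The degeneracy of [T]. *)
Definition almost_disjoint_almost_null : Prop :=
  forall (e : R) h, 0 < e -> 0 <=F h ->
    exists g, [/\ `|g| = 1, `|T g| < e & `|meet (abs g) h| < e].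

Lemma inf_DNS_not_almost : ~ almost_disjoint_almost_null -> inf_DNS join T.
Proof.
apply: contra_notP => nD e h e0 h0.
(* The failure is used with [r = e / 2] and [s = e]: some disjoint unit sequence has images of norm
   below [e] at arbitrarily late indices. *)
have := nD; move/forallNP/(_ (e / 2))/not_andP => [|]; first by case; lra.
move=> /existsNP[f /not_implyP[fd /not_implyP[f1 /forallNP nf]]].
have [N fN] := disjoint_seq_un_null HF Hoc fd h0 e0.
have /not_andP[[]|/forallNP/(_ N)/existsNP[n /not_implyP[Nn]]] := nf e; first lra.
by move/negP; rewrite -ltNge => Tf; exists (f n); split=> //; [exact: f1|exact: fN].
Qed.

Lemma n_DNS_not_almost : ~ almost_disjoint_almost_null ->
  exists n : nat, (2 <= n)%N /\ n_DNS join T n.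
Proof.
apply: contra_notP => /forallNP nD e h e0 h0.
have [n nP] := uniform_exhaustion HF Hoc h0 e0.
(* Length [n.+2] guarantees at least 2; only the first [n] members are used. *)
have /not_andP[//|/forallNP/(_ (e / 2))/not_andP[[]|]] := nD n.+2; first lra.
move=> /contrapT[f [fd f1 Tf]]; pose w i := f (widen_ord (leqW (leqnSn n)) i).
have m0 i : 0 <=F meet (abs (w i)) h.
  by apply: (meet_ge0 HF) => //; exact: abs_ge0 HF _.
have [i j ij|//|i|i wi] := nP (fun i => meet (abs (w i)) h).
- apply: (pdisj_le HF (m0 i) (m0 j)); try exact: lef_meetl HF _ _.
  by apply/(disjointP HF); apply: fd; apply: contra_neq ij => /(congr1 val)/= /val_inj.
- exact: lef_meetr HF _ _.
- exists (w i); split=> //; first exact: f1.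
  by apply: le_lt_trans (Tf _) _; lra.
Qed.

Lemma complements_not_almost :
  ~ almost_disjoint_almost_null -> complements_tauF le join T.
Proof.
move=> nA D ord f [_ [_ [_ dir]]] [f1 fnull Tf]; apply: nA => e h e0 h0.
have [p pP] := fnull h h0 e e0; have [q qP] := Tf e e0.
have [s [ps qs]] := dir p q.
exists (f s); split; first exact: f1.
  by have := qP s qs; rewrite normr_id.
by have := pP s ps; rewrite normr_id.
Qed.

Lemma linear_comb_cut (f : nat -> F) (c d : nat -> R) (a : R) n m :
  \sum_(0 <= i < maxn n m) (a * (if (i < n)%N then c i else 0) +
      (if (i < m)%N then d i else 0)) *: f i =
  a *: \sum_(0 <= i < n) c i *: f i + \sum_(0 <= i < m) d i *: f i.
Proof.
rewrite -(sum_cut c f (leq_maxl n m)) -(sum_cut d f (leq_maxr n m)).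
by rewrite scaler_sumr -big_split/=; apply: eq_bigr => i _; rewrite scalerDl scalerA.
Qed.

(** The combinations of the [f i] with [i >= N] form an infinite-dimensional subspace of the closed
    span, on which [e] cannot be a lower bound for [T]; a violating vector is normalised. *)
Lemma singular_block (f : nat -> F) (e : R) N :
  disjoint_seq join f -> (forall n, f n != 0) ->
  strictly_singular_on T (closed_span f) -> 0 < e ->
  exists n (b : nat -> R), [/\ (forall i, (i < N)%N -> b i = 0),
    `|\sum_(0 <= i < n) b i *: f i| = 1 & `|T (\sum_(0 <= i < n) b i *: f i)| < e].
Proof.
move=> fd f0 sing e0.
pose Y := [set x | exists n (b : nat -> R), (forall i, (i < N)%N -> b i = 0) /\
  x = \sum_(0 <= i < n) b i *: f i]%classic.
have Ysub : Defs.subspace Y.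
  split; first by exists 0, (fun=> 0); split=> //; rewrite big_geq.
  move=> a x y [n [c [c0 ->]]] [m [d [d0 ->]]].
  exists (maxn n m), (fun i => a * (if (i < n)%N then c i else 0) +
      (if (i < m)%N then d i else 0)); rewrite linear_comb_cut; split=> // i iN.
  by rewrite c0// d0//; do 2 case: ifP => _; rewrite mulr0 addr0.
have Yf : (Y `<=` closed_span f)%classic.
  move=> x [n [b [_ ->]]]; apply: subset_closure.
  by exists n, b; rewrite big_mkord.
have Yinf : infinite_dim Y.
  move=> n; exists (fun i => f (N + i)%N); split=> [i|a a0 i].
    exists (N + i).+1, (fun j => if j == (N + i)%N then 1 else 0); split.
      by move=> j jN; rewrite ltn_eqF// (leq_trans jN)// leq_addr.
    rewrite big_nat_recr//= eqxx scale1r big_nat big1 ?add0r// => j /andP[_ jN].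
    by rewrite ltn_eqF// scale0r.
  have : `|a i *: f (N + i)%N| <= `|\sum_(i < n) a i *: f (N + i)%N|.
    rewrite (bigD1 i)//=; apply: (norm_disjoint_add HF); apply: (disjoint_sumr HF).
    move=> j ji; apply: (disjoint_scaler HF); apply: (disjointC HF).
    apply: (disjoint_scaler HF); apply: fd => /addnI/val_inj/eqP.
    by rewrite (negbTE ji).
  by rewrite a0 normr0 normr_le0 scaler_eq0 (negbTE (f0 _)) orbF => /eqP.
have /forallNP/(_ e)/not_andP[//|/existsNP[x /not_implyP[Yx /negP]]] :=
  sing Y Ysub Yf Yinf.
rewrite -ltNge => Tx.
have x0 : 0 < `|x|.
  rewrite lt_neqAle normr_ge0 andbT eq_sym; apply: contraTneq Tx => x0.
  by rewrite x0 mulr0 -leNgt.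
have [n [b [b0 bE]]] : Y (`|x|^-1 *: x).
  by rewrite -[_ *: _]addr0; apply: Ysub.2 => //; exact: Ysub.1.
exists n, b; rewrite -bE; split=> //.
  by rewrite normrZ ger0_norm ?invr_ge0// mulVf// gt_eqF.
by rewrite linearZZ normrZ ger0_norm ?invr_ge0// mulrC ltr_pdivrMr.
Qed.

Lemma DNS_not_almost : ~ almost_disjoint_almost_null -> DNS join T.
Proof.
move=> nA f fd f0 sing; apply: nA => e h e0 h0.
have /choice[n /choice[b bP]] N := singular_block N fd f0 sing e0.
(* [B j] is where the [j]-th block starts; it is at least the length of every earlier block, so the
   blocks have disjoint supports. *)
pose B := fix B j := if j is j'.+1 then maxn (B j') (n (B j')) else 0.
pose g j := \sum_(0 <= i < n (B j)) b (B j) i *: f i.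
have B_inc j l : (j < l)%N -> (n (B j) <= B l)%N.
  elim: l => // l IH; rewrite ltnS leq_eqVlt => /predU1P[->|/IH jl].
    exact: leq_maxr.
  exact: leq_trans jl (leq_maxl _ _).
have gd j l : (j < l)%N -> Defs.disjoint join (g j) (g l).
  move=> jl; apply: (disjoint_sumr HF) => i _; apply: (disjointC HF).
  rewrite /g big_nat; apply: (disjoint_sumr HF) => k /andP[_ kn].
  apply: (disjoint_scaler HF); apply: (disjointC HF).
  have [iB|Bi] := ltnP i (B l).
    have [-> // _ _] := bP (B l); rewrite scale0r; exact: disjoint0r HF _.
  apply: (disjoint_scaler HF); apply: fd => ki.
  by have := leq_trans kn (leq_trans (B_inc _ _ jl) Bi); rewrite ki ltnn.
have gdisj : disjoint_seq join g.
  move=> j l; have [jl|lj|//] := ltngtP j l => _; first exact: gd.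
  by apply: (disjointC HF); exact: gd.
have [N gN] := disjoint_seq_un_null HF Hoc gdisj h0 e0.
have [_ g1 Tg] := bP (B N).
by exists (g N); split=> //; exact: gN.
Qed.

Lemma complements_seq_complements :
  complements_tauF le join T -> seq_complements_tauF le join T.
Proof.
move=> cT f [f1 fnull Tf]; apply: (cT nat (fun n m => n <= m)%N f).
  split; first by constructor; exact: 0.
  split; first exact: leqnn.
  split; first by move=> p q r pq qr; exact: leq_trans qr.
  by move=> p q; exists (maxn p q); rewrite leq_maxl leq_maxr.
split=> //; last exact/cvg0_seqP.
by move=> h /fnull/cvg0_seqP.
Qed.

(** * Conditions refuted by a disjoint unit sequence with small images *)

Section DisjointAlmostNull.
Variable f : nat -> F.
Hypotheses (fd : disjoint_seq join f) (f1 : forall m, `|f m| = 1).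
Hypothesis Tf : forall m, `|T (f m)| <= 2^-1 ^+ m.

Lemma inf_DNS_disjoint_null : ~ inf_DNS join T.
Proof.
move=> [r [r0 /(_ f fd f1)[s [rs [N sN]]]]].
have [M Mr] := half_exp_lt r0.
have := sN _ (leq_maxl N M); have := Tf (maxn N M); have := Mr _ (leq_maxr N M); lra.
Qed.

Lemma n_DNS_disjoint_null n : ~ n_DNS join T n.
Proof.
move=> [r [r0]]; apply; have [M Mr] := half_exp_lt r0.
exists (fun i => f (M + i)%N); split => [i j ij|i|i].
- by apply: fd => /addnI/val_inj/eqP; rewrite (negbTE ij).
- exact: f1.
- by apply: le_trans (Tf _) _; rewrite ltW// Mr// leq_addr.
Qed.

Lemma seq_complements_disjoint_null : ~ seq_complements_tauF le join T.
Proof.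
move=> /(_ f); apply; split=> //.
  move=> h h0; apply/cvg0_seqP => e e0.
  have [N fN] := disjoint_seq_un_null HF Hoc fd h0 e0.
  by exists N => n /fN; rewrite normr_id.
apply/cvg0_seqP => e e0; have [N eN] := half_exp_lt e0.
by exists N => n /eN; rewrite normr_id; exact: le_lt_trans.
Qed.

End DisjointAlmostNull.

End DisjointlyNonSingular.

Theorem mainTheorem1 (R : realType) (F : completeNormedModType R)
  (le : F -> F -> Prop) (join : F -> F -> F)
  (HF : is_normed_lattice le join) (Hoc : order_continuous le)
  (H : completeNormedModType R) (T : {linear F -> H})
  (Tbdd : exists C : R, forall x : F, `|T x| <= C * `|x|) :
  [<-> DNS join T;
       inf_DNS join T;
       exists n : nat, (2 <= n)%N /\ n_DNS join T n;
       complements_tauF le join T;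
       seq_complements_tauF le join T].
Proof.
have [C [C0 TC]] : exists C : R, 0 <= C /\ forall x, `|T x| <= C * `|x|.
  have [C TC] := Tbdd; exists `|C|; split=> // x.
  by apply: le_trans (TC x) _; apply: ler_wpM2r => //; exact: ler_norm.
have seqP := almost_disjoint_to_disjoint HF C0 TC.
(* Except from nets to sequences, each implication passes through non-degeneracy: degeneracy would
   give, by [seqP], a disjoint sequence refuting the premise. *)
split; [|split; [|split; [|split]]].
- move=> dns; apply: (inf_DNS_not_almost HF Hoc) => /seqP[f [fd f1 Tf]].
  apply: (dns f fd); last exact: (small_disjoint_strictly_singular HF C0 TC fd f1 Tf).
  by move=> n; rewrite -normr_gt0 f1.
- move=> idns; apply: (n_DNS_not_almost HF Hoc) => /seqP[f [fd f1 Tf]].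
  exact: inf_DNS_disjoint_null fd f1 Tf idns.
- move=> [n [_ ndns]]; apply: complements_not_almost => /seqP[f [fd f1 Tf]].
  exact: n_DNS_disjoint_null fd f1 Tf _ ndns.
- exact: complements_seq_complements.
- move=> sc; apply: (DNS_not_almost HF Hoc) => /seqP[f [fd f1 Tf]].
  exact: (seq_complements_disjoint_null HF Hoc fd f1 Tf sc).
Qed.
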